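(* Let $k,t$ be positive integers and let $n\geq 3tk+3t-5$. Then $r(K_{1,n-1},tB_k)=2n+t-2$.
   Context: For graphs $G,H$, the Ramsey number $r(G,H)$ is the smallest positive integer $N$ such that every red-blue coloring of the edges of the complete graph $K_N$ contains a red subgraph isomorphic to $G$ or a blue subgraph isomorphic to $H$. $K_{1,n-1}$ is the star with $n$ vertices. The book $B_k$ is the graph $K_2+\overline{K}_k$ on $k+2$ vertices (an edge together with $k$ further vertices each adjacent to both endpoints of the edge), and $tB_k$ denotes the disjoint union of $t$ vertex-disjoint copies of $B_k$. *)

(* Defs.v *)
From mathcomp Require Import all_boot.

Set Implicit Arguments.
Unset Strict Implicit.
Unset Printing Implicit Defensive.

Record sgraph := SGraph {
  svertex :> finType;
  sedge : rel svertex;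
  sedge_sym : symmetric sedge;
  sedge_irrefl : irreflexive sedge }.

(* Subgraph containment is not required to be induced. *)
Definition contains (G H : sgraph) : Prop :=
  exists f : H -> G, injective f /\
    forall x y : H, sedge x y -> sedge (f x) (f y).

Definition complete_rel n : rel 'I_n := fun x y => x != y.
Lemma complete_sym n : symmetric (@complete_rel n).
Proof. by move=> x y; rewrite /complete_rel eq_sym. Qed.
Lemma complete_irrefl n : irreflexive (@complete_rel n).
Proof. by move=> x; rewrite /complete_rel eqxx. Qed.
Definition complete n := SGraph (@complete_sym n) (@complete_irrefl n).

Definition edgeless_rel n : rel 'I_n := fun _ _ => false.
Lemma edgeless_sym n : symmetric (@edgeless_rel n).
Proof. by []. Qed.
Lemma edgeless_irrefl n : irreflexive (@edgeless_rel n).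
Proof. by []. Qed.
Definition edgeless n := SGraph (@edgeless_sym n) (@edgeless_irrefl n).

Definition join_rel (G H : sgraph) : rel (G + H)%type := fun x y =>
  match x, y with
  | inl a, inl b => sedge a b
  | inr a, inr b => sedge a b
  | _, _ => true
  end.
Lemma join_sym G H : symmetric (@join_rel G H).
Proof. by case=> a [] b //=; rewrite sedge_sym. Qed.
Lemma join_irrefl G H : irreflexive (@join_rel G H).
Proof. by case=> a /=; rewrite sedge_irrefl. Qed.
Definition join G H := SGraph (@join_sym G H) (@join_irrefl G H).

Definition copies_rel t (G : sgraph) : rel ('I_t * G)%type :=
  fun x y => (x.1 == y.1) && sedge x.2 y.2.
Lemma copies_sym t G : symmetric (@copies_rel t G).
Proof. by move=> x y; rewrite /copies_rel eq_sym sedge_sym. Qed.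
Lemma copies_irrefl t G : irreflexive (@copies_rel t G).
Proof. by move=> x; rewrite /copies_rel sedge_irrefl andbF. Qed.
Definition copies t G := SGraph (@copies_sym t G) (@copies_irrefl t G).

(* K_{1,m}, which has m.+1 vertices. *)
Definition star m := join (edgeless 1) (edgeless m).

Definition book k := join (complete 2) (edgeless k).

(* An edge colouring of K_N assigns a colour to each unordered pair [set x; y]
   with x != y; its values on sets of any other size are never used. *)
Definition edge_coloring N := {set 'I_N} -> bool.

Definition red : bool := true.
Definition blue : bool := false.

Definition color_rel N (c : edge_coloring N) (b : bool) : rel (complete N) :=
  fun x y => sedge x y && (c [set x; y] == b).
Lemma color_sym N (c : edge_coloring N) b : symmetric (color_rel c b).
Proof. by move=> x y; rewrite /color_rel sedge_sym setUC. Qed.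
Lemma color_irrefl N (c : edge_coloring N) b : irreflexive (color_rel c b).
Proof. by move=> x; rewrite /color_rel sedge_irrefl. Qed.
Definition color_graph N (c : edge_coloring N) b :=
  SGraph (color_sym c b) (color_irrefl c b).

Definition arrows N (G H : sgraph) : Prop :=
  forall c : edge_coloring N,
    contains (color_graph c red) G \/ contains (color_graph c blue) H.

(* The relation r(G, H) = N. *)
Definition ramsey_number (G H : sgraph) (N : nat) : Prop :=
  [/\ 0 < N, arrows N G H & forall M, 0 < M -> arrows M G H -> N <= M].

(* Main.v *)
Require Import Defs.
From mathcomp Require Import all_boot zify.

(* Lower bound: two red cliques of order n - 1, all other edges blue, together
   with t - 1 vertices joined to everything in blue; every blue triangle meets
   the t - 1 vertices.

   Upper bound: in a colouring of K_N, N = 2n + t - 2, without a red star, the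
   blue graph G has minimum degree at least n + t - 1.  Any family of s < t
   disjoint books in G can be enlarged.  Let S be the set of vertices covered by
   the family.  If G - S has a triangle, it has a book, by counting degrees.
   Otherwise G - S is bipartite by its minimum degree, with parts A and B, and
   the degree condition makes it almost complete bipartite; each vertex y of S
   then has so many neighbours in B that an edge from y to A is the spine of a
   book with pages in B, or the same holds with A and B exchanged.  Counting
   degrees from A and B into S, one finds t disjoint such spines.  Two of them end
   in the same book Q of the family, and Q can be traded for two new books. *)

Set Implicit Arguments.
Unset Strict Implicit.
Unset Printing Implicit Defensive.

(** * Counting in finite sets *)

Lemma subset_of_card (T : finType) (A : {set T}) m :
  m <= #|A| -> exists2 B : {set T}, B \subset A & #|B| = m.
Proof.
move=> lemA; have: 0 < #|[set B : {set T} | B \subset A & #|B| == m]|.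
  by rewrite cards_draws bin_gt0.
by case/card_gt0P=> B; rewrite inE => /andP[sBA /eqP]; exists B.
Qed.

(** Double counting of the pairs of an index [i] and an element of [A i]. *)
Lemma sum_mem_le (T : finType) (D : {set T}) (I : finType) (A : I -> {set T}) m :
    (forall i, A i \subset D) ->
    (forall z, z \in D -> \sum_i (z \in A i) <= m) ->
  \sum_i #|A i| <= m * #|D|.
Proof.
move=> sAD le_m.
have cardE i : #|A i| = \sum_(z in D) (z \in A i).
  rewrite -sum1_card big_mkcond [RHS]big_mkcond /=; apply: eq_bigr => z _.
  case: ifP => [/(subsetP (sAD i)) -> | _] //; by case: ifP.
rewrite (eq_bigr _ (fun i _ => cardE i)) exchange_big mulnC -sum_nat_const.
exact: leq_sum.
Qed.

(** * Triangle-free sets of large minimum degree, and greedy matchings *)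

Section Neighbourhoods.

Variable G : sgraph.
Implicit Types (x y z u v w : G) (A B D : {set G}).

Definition nbh x : {set G} := [set y | sedge x y].

Lemma in_nbh x y : (y \in nbh x) = sedge x y. Proof. by rewrite inE. Qed.

Definition independent A := forall x y, x \in A -> y \in A -> ~~ sedge x y.

Definition triangle_free D :=
  forall x y z, x \in D -> y \in D -> z \in D ->
    ~~ [&& sedge x y, sedge y z & sedge z x].

(* A vertex of a triangle-free graph sees at most two vertices of a closed
   walk of length five. *)
Lemma no_closed_walk5 D d v0 v1 v2 v3 v4 :
    triangle_free D -> (forall x, x \in D -> d <= #|nbh x :&: D|) ->
    2 * #|D| < 5 * d ->
    v0 \in D -> v1 \in D -> v2 \in D -> v3 \in D -> v4 \in D ->
    sedge v0 v1 -> sedge v1 v2 -> sedge v2 v3 -> sedge v3 v4 -> sedge v4 v0 ->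
  False.
Proof.
move=> tf dD ltd D0 D1 D2 D3 D4 e01 e12 e23 e34 e40.
pose c (i : 'I_5) := nth v0 [:: v0; v1; v2; v3; v4] i.
have := @sum_mem_le _ D _ (fun i => nbh (c i) :&: D) 2.
rewrite !big_ord_recl big_ord0 /= => /(_ (fun i => subsetIr _ _)).
have side z : z \in D ->
    \sum_i (z \in nbh (c i) :&: D) <= 2.
  move=> Dz; rewrite !big_ord_recl big_ord0 /= !inE Dz !andbT /c /=.
  have T x y : x \in D -> y \in D -> sedge x y -> ~~ (sedge x z && sedge y z).
    move=> Dx Dy exy; apply: contra (tf x y z Dx Dy Dz) => /andP[exz eyz].
    by rewrite exy eyz sedge_sym.
  move: (T _ _ D0 D1 e01) (T _ _ D1 D2 e12) (T _ _ D2 D3 e23)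
        (T _ _ D3 D4 e34) (T _ _ D4 D0 e40).
  by do 5![case: (sedge _ z)].
move=> /(_ side); rewrite /c /=.
by move: (dD _ D0) (dD _ D1) (dD _ D2) (dD _ D3) (dD _ D4); lia.
Qed.

(* The case of the Andrasfai-Erdos-Sos theorem excluding triangles. *)
Lemma bipartite_of_min_degree D d :
    triangle_free D -> (forall x, x \in D -> d <= #|nbh x :&: D|) ->
    2 * #|D| < 5 * d -> D != set0 ->
  exists A B, [/\ independent A, independent B, A :|: B = D,
    [disjoint A & B] & d <= #|A| /\ d <= #|B|].
Proof.
move=> tf dD ltd /set0Pn[u Du].
have d_gt0 : 0 < d by lia.
have [v] : exists v, v \in nbh u :&: D.
  by apply/set0Pn; rewrite -card_gt0; apply: leq_trans (dD u Du).
rewrite !inE => /andP[euv Dv].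
have evu : sedge v u by rewrite sedge_sym.
(* For the fixed edge [u v], the two parts are the vertices of [D] that share a neighbour in [D]
   with [u], and those that share one with [v]. *)
pose meets x w := [exists z in D, sedge x z && sedge z w].
have meetsP x w : reflect (exists z, [/\ z \in D, sedge x z & sedge z w]) (meets x w).
  apply: (iffP existsP) => [[z /and3P[]] | [z [? ? ?]]]; exists z => //.
  exact/and3P.
have cov w : w \in D -> meets u w || meets v w.
  move=> Dw; apply: contraT => /norP[nu nv].
  (* Otherwise [u], [v] and [w] have pairwise disjoint neighbourhoods in [D], so [3d <= |D|],
     against [2|D| < 5d]. *)
  pose I3 := [:: nbh u :&: D; nbh v :&: D; nbh w :&: D].
  have sI3 (i : 'I_3) : nth set0 I3 i \subset D.
    by case: i => -[|[|[|]]] //= _; apply: subsetIr.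
  have ndisj x : ~~ meets x w -> forall z, z \in D -> ~~ (sedge x z && sedge w z).
    move=> nx z Dz; apply: contra nx => /andP[exz ewz].
    by apply/meetsP; exists z; rewrite (sedge_sym z w).
  have le1 z : z \in D -> \sum_(i < 3) (z \in nth set0 I3 i) <= 1.
    move=> Dz; rewrite !big_ord_recl big_ord0 /= !inE Dz !andbT.
    move: (tf u v z Du Dv Dz) (ndisj u nu z Dz) (ndisj v nv z Dz).
    rewrite euv (sedge_sym z u) /=.
    by do 3![case: (sedge _ z)].
  have := sum_mem_le sI3 le1; rewrite !big_ord_recl big_ord0 /=.
  by move: (dD _ Du) (dD _ Dv) (dD _ Dw); lia.
(* A vertex in both parts closes a walk of length five through [u] and [v]; an edge inside a part
   closes one through [x]. *)
have disj w : w \in D -> meets u w -> meets v w -> False.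
  move=> Dw /meetsP[b [Db eub ebw]] /meetsP[a [Da eva eaw]].
  apply: (no_closed_walk5 tf dD ltd Dv Da Dw Db Du) => //.
    by rewrite sedge_sym.
  by rewrite sedge_sym.
have ind x : x \in D -> independent [set w in D | meets x w].
  move=> Dx w w'; rewrite !inE => /andP[Dw /meetsP[b [Db exb ebw]]].
  move=> /andP[Dw' /meetsP[b' [Db' exb' ebw']]]; apply/negP => eww'.
  apply: (no_closed_walk5 tf dD ltd Dx Db Dw Dw' Db') => //.
    by rewrite sedge_sym.
  by rewrite sedge_sym.
exists [set w in D | meets u w], [set w in D | meets v w]; split.
- exact: ind.
- exact: ind.
- apply/setP => w; rewrite !inE -andb_orr.
  by case: (boolP (w \in D)) => // /cov.
- rewrite -setI_eq0; apply/eqP/setP => w; rewrite !inE.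
  by apply/negP => /andP[/andP[Dw uw] /andP[_ vw]]; apply: (disj w).
(* The first part contains all neighbours of [v] in [D], since [v] itself is the neighbour they
   share with [u]; the second is symmetric. *)
- split.
    apply: leq_trans (dD v Dv) _; apply/subset_leq_card/subsetP => w.
    by rewrite !inE => /andP[evw Dw]; rewrite Dw; apply/meetsP; exists v.
  apply: leq_trans (dD u Du) _; apply/subset_leq_card/subsetP => w.
  by rewrite !inE => /andP[evw Dw]; rewrite Dw; apply/meetsP; exists u.
Qed.

(** Edges are chosen one by one: fewer chosen edges than the bound cannot exhaust [A], nor the
    neighbours in [Y] of the next vertex of [A]. *)
Lemma greedy_matching A (Y : {set G}) m :
    m <= #|A| -> (forall z, z \in A -> m <= #|nbh z :&: Y|) ->
  exists l : seq (G * G), [/\ size l = m, uniq (map fst l), uniq (map snd l)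
    & forall p, p \in l -> [/\ p.1 \in A, p.2 \in Y & sedge p.1 p.2]].
Proof.
elim: m => [|m IH] leA leY; first by exists [::].
have [||l [sl u1 u2 lP]] := IH; first exact: ltnW.
  by move=> z /leY; apply: ltnW.
have fresh (X : {set G}) (s : seq G) : size s = m -> m < #|X| ->
    exists2 x, x \in X & x \notin s.
  move=> ss ltX; have : 0 < #|X :\: [set x in s]|.
    rewrite cardsD subn_gt0; apply: leq_ltn_trans ltX.
    apply: leq_trans (subset_leq_card (subsetIr _ _)) _.
    by rewrite cardsE -ss card_size.
  by case/card_gt0P => x; rewrite !inE => /andP[]; exists x.
have [z Az zl] : exists2 z, z \in A & z \notin map fst l.
  by apply: fresh; rewrite ?size_map.
have [y] : exists2 y, y \in nbh z :&: Y & y \notin map snd l.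
  by apply: fresh; rewrite ?size_map ?leY.
rewrite !inE => /andP[ezy Yy] yl; exists ((z, y) :: l); split => /=.
- by rewrite sl.
- by rewrite zl.
- by rewrite yl.
by move=> p; rewrite inE => /predU1P[-> //|/lP].
Qed.

End Neighbourhoods.

(** * Books as vertex sets, and families of disjoint books *)

Section Books.

Variables (G : sgraph) (k : nat).
Implicit Types (x y z u v : G) (A B D Q W : {set G}) (P : {set {set G}}).

(** Only the vertex set is kept, with spine [x y] and pages [W] hidden, so that disjoint books form
    a [trivIset] family. *)
Definition is_book Q := exists x y W,
  [/\ sedge x y, #|W| = k, W \subset nbh x :&: nbh y & Q = x |: (y |: W)].

Definition disjoint_books P := trivIset P /\ forall Q, Q \in P -> is_book Q.

Lemma card_book Q : is_book Q -> #|Q| = k.+2.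
Proof.
move=> [x [y [W [exy cW /subsetP sW ->]]]]; rewrite !cardsU1 cW !inE negb_or.
have nx : x \notin W by apply/negP => /sW; rewrite !inE sedge_irrefl.
have ny : y \notin W by apply/negP => /sW; rewrite !inE sedge_irrefl andbF.
have nxy : x != y by apply: contraTneq exy => ->; rewrite sedge_irrefl.
by rewrite nx ny nxy.
Qed.

Lemma set0_not_book P : disjoint_books P -> set0 \notin P.
Proof. by case=> _ bP; apply/negP => /bP/card_book; rewrite cards0. Qed.

Lemma card_cover_books P : disjoint_books P -> #|cover P| = #|P| * k.+2.
Proof.
move=> bP; apply: card_uniform_partition => [Q /(proj2 bP)/card_book //|].
by rewrite /partition eqxx (proj1 bP) set0_not_book.
Qed.

Lemma add_book P Q :
    disjoint_books P -> is_book Q -> [disjoint Q & cover P] ->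
  disjoint_books (Q |: P) /\ #|Q |: P| = #|P|.+1.
Proof.
move=> bP bQ dQ; have [||| tP nQ] := @trivIsetU1 _ Q P.
- move=> B PB; apply: disjointWr dQ; exact: bigcup_sup.
- exact: (proj1 bP).
- exact: set0_not_book.
split; last by rewrite cardsU1 nQ.
by split=> // B /setU1P[-> // | /(proj2 bP)].
Qed.

Lemma remove_book P Q : disjoint_books P -> Q \in P ->
  [/\ disjoint_books (P :\ Q), cover (P :\ Q) = cover P :\: Q
    & #|P| = #|P :\ Q|.+1].
Proof.
move=> [tP bP] PQ; split; last by rewrite (cardsD1 Q) PQ.
  split; first by apply: trivIsetS tP; apply: subD1set.
  by move=> B /setD1P[_ /bP].
exact: coverD1.
Qed.

(** Removing [Q] frees [y] and [y'], which become ends of the spines of two new books. The first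
    takes [k] pages of [W] other than [z']; the second must avoid [z] and these [k] pages, which the
    [2k + 1] vertices of [W'] allow. *)
Lemma split_book P Q y y' z z' W W' :
    disjoint_books P -> Q \in P -> y \in Q -> y' \in Q -> y != y' ->
    z \notin cover P -> z' \notin cover P -> z != z' ->
    sedge z y -> sedge z' y' ->
    W \subset (nbh z :&: nbh y) :\: cover P -> k < #|W| ->
    W' \subset (nbh z' :&: nbh y') :\: cover P -> k.*2 < #|W'| ->
  exists P', disjoint_books P' /\ #|P'| = #|P|.+1.
Proof.
move=> bP PQ Qy Qy' ny Cz Cz' nz ezy ezy' sW cW sW' cW'.
have [bP1 cP1 nP1] := remove_book bP PQ.
have Cq x : x \in Q -> x \in cover P by move=> Qx; apply/bigcupP; exists Q.
have [|X sX cX] := @subset_of_card _ (W :\ z') k.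
  by have := cardsD1 z' W; case: (z' \in W) => /=; lia.
have [|X' sX' cX'] := @subset_of_card _ (W' :\: (z |: X)) k.
  rewrite cardsD; have := subset_leq_card (subsetIr W' (z |: X)).
  by rewrite cardsU1 cX; case: (z \in X) => /=; lia.
have XP x : x \in X -> [/\ x != z', sedge z x, sedge y x & x \notin cover P].
  move=> /(subsetP sX); rewrite !inE => /andP[nx /(subsetP sW)].
  by rewrite !inE => /andP[? /andP[]].
have X'P x : x \in X' ->
    [/\ x != z, x \notin X, sedge z' x, sedge y' x & x \notin cover P].
  move=> /(subsetP sX'); rewrite !inE negb_or => /andP[/andP[? ?] /(subsetP sW')].
  by rewrite !inE => /andP[? /andP[]].
pose B := z |: (y |: X); pose B' := z' |: (y' |: X').
have bB : is_book B.
  exists z, y, X; split=> //; apply/subsetP => x /XP[? ? ? ?]; rewrite !inE.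
  exact/andP.
have bB' : is_book B'.
  exists z', y', X'; split=> //; apply/subsetP => x /X'P[? ? ? ? ?]; rewrite !inE.
  exact/andP.
have [|bP2 cP2] := add_book bP1 bB.
  rewrite cP1 -setI_eq0; apply/eqP/setP => x; rewrite !inE; apply/negP.
  case/andP => /or3P[/eqP-> | /eqP-> | /XP[_ _ _ /negPf->]]; last by rewrite andbF.
    by rewrite (negPf Cz) andbF.
  by rewrite Qy.
have [|bP3 cP3] := add_book bP2 bB'; last first.
  by exists (B' |: (B |: P :\ Q)); split=> //; rewrite cP3 cP2 nP1.
rewrite -setI_eq0; apply/eqP/setP => x; rewrite [RHS]inE; apply/negP.
case/setIP => xB' /bigcupP[E /setU1P[-> | PE] xE].
  move: xB' xE; rewrite !inE.
  case/or3P=> [/eqP-> | /eqP-> | xX'].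
  - rewrite eq_sym (negPf nz) /= => /orP[/eqP E' | /XP[]]; last by rewrite eqxx.
    by move: Cz'; rewrite E' Cq.
  - case/or3P => [/eqP E'|/eqP E'|/XP[_ _ _]]; last by rewrite Cq.
      by move: Cz; rewrite -E' Cq.
    by move: ny; rewrite E' eqxx.
  have [nxz nxX _ _ nxP] := X'P x xX'.
  by rewrite (negPf nxz) (negPf nxX) orbF => /eqP E'; move: nxP; rewrite E' Cq.
have : x \in cover (P :\ Q) by apply/bigcupP; exists E.
rewrite cP1; move: xB'; rewrite !inE.
case/or3P=> [/eqP-> | /eqP-> | /X'P[_ _ _ _ /negPf->]]; last by rewrite andbF.
  by rewrite (negPf Cz') andbF.
by rewrite Qy'.
Qed.

Lemma book_of_common x y D :
    sedge x y -> k <= #|nbh x :&: nbh y :&: D| -> x \in D -> y \in D ->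
  exists2 Q, is_book Q & Q \subset D.
Proof.
move=> exy /subset_of_card[W sW cW] Dx Dy; exists (x |: (y |: W)).
  by exists x, y, W; split=> //; apply: subset_trans sW (subsetIl _ _).
apply/subsetP => z; rewrite !inE => /or3P[/eqP->|/eqP->|/(subsetP sW)] //.
by rewrite !inE => /andP[].
Qed.

(** By inclusion-exclusion, three neighbourhoods of total size above [|D| + 3(k - 1)] include two
    that share at least [k] vertices; these are pages on an edge of the triangle. *)
Lemma book_of_triangle D d x y z :
    (forall v, v \in D -> d <= #|nbh v :&: D|) -> #|D| + 3 * k < 3 * d + 3 ->
    x \in D -> y \in D -> z \in D ->
    sedge x y -> sedge y z -> sedge z x ->
  exists2 Q, is_book Q & Q \subset D.
Proof.
move=> dD ltD Dx Dy Dz exy eyz ezx.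
have [|lxy] := leqP k #|nbh x :&: nbh y :&: D|.
  by move/book_of_common; apply.
have [|lyz] := leqP k #|nbh y :&: nbh z :&: D|.
  by move/book_of_common; apply.
have [|lzx] := leqP k #|nbh z :&: nbh x :&: D|.
  by move/book_of_common; apply.
pose X v := nbh v :&: D.
have: #|X x| + #|X y| + #|X z| <=
    #|D| + #|X x :&: X y| + #|X y :&: X z| + #|X z :&: X x|.
  have := cardsUI (X x) (X y); have := cardsUI (X x :|: X y) (X z).
  have : #|X x :|: X y :|: X z| <= #|D|.
    by apply: subset_leq_card; rewrite !subUset !subsetIr.
  have : #|(X x :|: X y) :&: X z| <= #|X y :&: X z| + #|X z :&: X x|.
    rewrite setIUl (setIC (X x)) addnC; apply: leq_card_setU.
  lia.
rewrite /X -!setIIl.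
by move: (dD x Dx) (dD y Dy) (dD z Dz); lia.
Qed.

End Books.

Arguments disjoint_books : clear implicits.

(** * The upper bound: enlarging a family of disjoint books *)

Section UpperBound.

Variables (G : sgraph) (k t n : nat).
Hypotheses (k_gt0 : 0 < k) (leq_n : 3 * t * k + 3 * t - 5 <= n).
Hypothesis cardG : #|G| = 2 * n + t - 2.
Hypothesis degG : forall x : G, n + t - 1 <= #|nbh x|.

Lemma extend_books (P : {set {set G}}) :
  disjoint_books G k P -> #|P| < t ->
  exists P', disjoint_books G k P' /\ #|P'| = #|P|.+1.
Proof.
move=> bP ltPt; set S := cover P; pose D := ~: S.
have cS : #|S| = #|P| * k.+2 := card_cover_books bP.
have cD : #|D| + #|S| = #|G| by rewrite -(cardsC S) addnC.
have leS : #|S| + k + 2 <= t * k + 2 * t by rewrite cS; nia.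
(* This is [(t - 1)(k - 1) >= 0]. *)
have tk_gt0 : t + k <= t * k + 1 by nia.
have deg_in (A B : {set G}) (x : G) : nbh x \subset A :|: B ->
    n + t - 1 <= #|nbh x :&: A| + #|nbh x :&: B|.
  move=> /setIidPl sxAB; apply: leq_trans (degG x) _.
  by rewrite -{1}sxAB setIUr; apply: leq_card_setU.
pose d := n + t - 1 - #|S|.
have dD x : x \in D -> d <= #|nbh x :&: D|.
  move=> _; have := deg_in D S x; rewrite setUC setUCr subsetT => /(_ isT).
  have := subset_leq_card (subsetIr (nbh x) S); rewrite /d; lia.
have add Q : is_book k Q -> Q \subset D ->
    exists P', disjoint_books G k P' /\ #|P'| = #|P|.+1.
  move=> bQ sQ; exists (Q |: P); apply: add_book => //.
  by rewrite -setI_eq0 setI_eq0 disjoints_subset.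
have leq_n' : 3 * (t * k) + 3 * t <= n + 5 by lia.
case: (boolP [exists x in D, exists y in D, exists z in D,
    [&& sedge x y, sedge y z & sedge z x]]) => [|notri].
  case/existsP=> x /andP[Dx /existsP[y /andP[Dy /existsP[z]]]].
  case/andP=> Dz /and3P[exy eyz ezx].
  have [|Q bQ sQ] := book_of_triangle (k := k) dD _ Dx Dy Dz exy eyz ezx.
    by rewrite /d; lia.
  exact: add bQ sQ.
have tf : triangle_free D.
  move=> x y z Dx Dy Dz; apply: contra notri => T.
  apply/existsP; exists x; rewrite Dx; apply/existsP; exists y; rewrite Dy.
  by apply/existsP; exists z; rewrite Dz.
have [||A [B [indA indB AUB dAB [leA leB]]]] := bipartite_of_min_degree tf dD.
(* In terms of [S] this reads [3|S| < n + 3t - 1]; it follows from [|S| <= (t - 1)(k + 2)] and the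
   bound on [n]. *)
- by rewrite /d; lia.
- by rewrite -card_gt0; lia.
have cAB : #|A| + #|B| + #|S| = 2 * n + t - 2.
  by rewrite -cardG -cD -AUB; move: dAB; rewrite -leq_card_setU => /eqP->.
have le_d : t <= d by rewrite /d; lia.
(* An edge from [z] in [A] to a vertex [y] that is rich for [A] and [B] is the
   spine of a book with pages in [B], with enough pages for two books. *)
pose rich (A B : {set G}) := [set y in S | n + k.*2 <= #|nbh y :&: B| + #|A|].
pose parts (A B : {set G}) :=
  [/\ independent A, A :|: B = D & #|A| + #|B| + #|S| = 2 * n + t - 2].
have nbh_part (A' B' : {set G}) z : parts A' B' -> z \in A' ->
    nbh z \subset B' :|: S.
  move=> [ind defD _] Az; apply/subsetP => x; rewrite in_nbh => ezx.
  have: (x \in A') || (x \in B') || (x \in S).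
    by rewrite -!in_setU defD setUC setUCr inE.
  by rewrite inE -orbA; case/orP => // Ax; case/negP: (ind z x Az Ax).
(* In [B'], [z] has at least [n + t - 1 - |S|] neighbours and [y] at least [n + 2k - |A'|]. The sum
   exceeds [|B'|] by at least [2k + 1], which explains the threshold in [rich]. *)
have pages (A' B' : {set G}) z y : parts A' B' ->
    z \in A' -> y \in rich A' B' -> k.*2 < #|nbh z :&: nbh y :&: B'|.
  move=> AB' Az; rewrite inE => /andP[_ rich_y].
  have := deg_in _ _ _ (nbh_part _ _ _ AB' Az); case: AB' => _ _ cAB'.
  have := cardsUI (nbh z :&: B') (nbh y :&: B'); rewrite -setIIl -setIUl.
  have := subset_leq_card (subsetIr (nbh z :|: nbh y) B').
  have := subset_leq_card (subsetIr (nbh z) S).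
  lia.
(* A vertex of [A'] loses at most [|B'|] neighbours to [B'] and [|S :\: Y|] to the rest of [S]; all
   others lie in [Y]. The cap [t] keeps the size below [|A'|]. *)
have matching (A' B' Y : {set G}) : parts A' B' -> d <= #|A'| -> Y \subset S ->
  exists l : seq (G * G),
    [/\ size l = minn t (n + t - 1 - #|B'| - #|S :\: Y|),
        uniq (map fst l), uniq (map snd l) & forall p, p \in l ->
        [/\ p.1 \in A', p.2 \in Y & sedge p.1 p.2]].
  move=> AB' leA' sYS; apply: greedy_matching => [|z Az]; first lia.
  have := deg_in _ _ _ (nbh_part _ _ _ AB' Az).
  have := subset_leq_card (subsetIr (nbh z) B').
  have : #|nbh z :&: S| <= #|nbh z :&: Y| + #|S :\: Y|.
    rewrite -(cardsID Y (nbh z :&: S)) -setIA (setIidPr sYS) leq_add2l.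
    by apply: subset_leq_card; apply/setSD/subsetIr.
  lia.
have pAB : parts A B by [].
have pBA : parts B A by split; rewrite // 1?setUC // (addnC #|B|).
(* Not being its own neighbour, [y] has at least [n + t - |S|] neighbours in [A] and [B] together;
   if few lie in [B], enough lie in [A]. *)
have poorP : S :\: rich A B \subset rich B A.
  apply/subsetP => y /setDP[Sy]; rewrite !inE Sy /= -ltnNge => poor.
  (* As [S] contains [y], the family is nonempty, so [t >= 2] and [2k <= tk], which the count below
     needs. *)
  have P_gt0 : 0 < #|P|.
    by rewrite card_gt0; apply: contraTneq Sy => P0; rewrite /S P0 /cover big_set0 inE.
  have : 2 * k <= t * k by rewrite leq_mul2r; lia.
  have := deg_in (A :|: B) (S :\ y) y.
  have -> : nbh y \subset A :|: B :|: S :\ y.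
    apply/subsetP => x; rewrite in_nbh AUB !inE => eyx.
    have -> : x != y by apply: contraTneq eyx => ->; rewrite sedge_irrefl.
    by rewrite orNb.
  move=> /(_ isT); rewrite setIUr.
  have [+ _] := leq_card_setU (nbh y :&: A) (nbh y :&: B).
  have := subset_leq_card (subsetIr (nbh y) (S :\ y)).
  have := cardsD1 y S; rewrite Sy.
  lia.
have sRS : rich A B \subset S by apply/subsetP => y; rewrite inE => /andP[].
have [l1 [s1 u11 u12 l1P]] := matching _ _ _ pAB leA sRS.
have [l2 [s2 u21 u22 l2P]] := matching _ _ _ pBA leB (subsetDl S (rich A B)).
pose l := l1 ++ l2.
(* The terms subtracted in the two sizes add up to [|A| + |B| + |S| = 2n + t - 2], so without the
   caps the sizes add up to at least [t]. *)
have sl : t <= size l.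
  rewrite size_cat s1 s2 setDDr setDv set0U (setIidPr sRS).
  by have := cardsID (rich A B) S; rewrite (setIidPr sRS); lia.
have ul1 : uniq (map fst l).
  rewrite map_cat cat_uniq u11 u21 andbT /=; apply/hasPn => z /mapP[p /l2P[Bp _ _] ->].
  apply/mapP => -[q /l1P[Aq _ _] E]; move: Aq.
  by rewrite -E (disjointFl dAB Bp).
have ul2 : uniq (map snd l).
  rewrite map_cat cat_uniq u12 u22 andbT /=; apply/hasPn => y /mapP[p /l2P[_ + _] ->].
  rewrite inE => /andP[poor _]; apply/mapP => -[q /l1P[_ + _] E].
  by rewrite -E (negPf poor).
have lP p : p \in l -> exists W : {set G},
    [/\ p.1 \notin S, p.2 \in S, sedge p.1 p.2,
        W \subset (nbh p.1 :&: nbh p.2) :\: S & k.*2 < #|W|].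
  have DP x : x \in D -> x \notin S by rewrite inE.
  rewrite mem_cat => /orP[/l1P | /l2P] [Ap Yp ep].
    exists (nbh p.1 :&: nbh p.2 :&: B); split=> //.
    - by apply: DP; rewrite -AUB inE Ap.
    - exact: (subsetP sRS).
    - by rewrite setDE setIS // -/D -AUB subsetUr.
    exact: pages pAB Ap Yp.
  exists (nbh p.1 :&: nbh p.2 :&: A); split=> //.
  - by apply: DP; rewrite -AUB inE Ap orbT.
  - by case/setDP: Yp.
  - by rewrite setDE setIS // -/D -AUB subsetUl.
  exact: pages pBA Ap (subsetP poorP _ Yp).
(* Pigeonhole: at least [t] edges end in fewer than [t] books. *)
have : ~~ uniq (map (fun p => pblock P p.2) l).
  have sub : {subset map (fun p => pblock P p.2) l <= enum P}.
    move=> Q /mapP[p /lP[W [_ Sp _ _ _]] ->].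
    by rewrite mem_enum pblock_mem.
  apply/negP => /uniq_leq_size/(_ sub); rewrite size_map -cardE.
  by rewrite leqNgt (leq_trans ltPt sl).
case: l => [//|p0 l'] in sl ul1 ul2 lP *.
set L := p0 :: l' in sl ul1 ul2 lP *.
case/(uniqPn (pblock P p0.2)) => i [j [ltij ltj]]; rewrite size_map in ltj.
have lti := ltn_trans ltij ltj; rewrite !(nth_map p0) // => Eblock.
have [W [C1 Sy e1 sW cW]] := lP _ (mem_nth p0 lti).
have [W' [C1' Sy' e1' sW' cW']] := lP _ (mem_nth p0 ltj).
apply: (split_book bP (pblock_mem Sy) _ _ _ C1 C1' _ e1 e1' sW _ sW' cW').
- by rewrite mem_pblock.
- by rewrite Eblock mem_pblock.
- rewrite -!(nth_map p0 p0.2 snd) // nth_uniq ?size_map //.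
  by rewrite neq_ltn ltij.
- rewrite -!(nth_map p0 p0.1 fst) // nth_uniq ?size_map //.
  by rewrite neq_ltn ltij.
by apply: leq_ltn_trans cW; rewrite -addnn leq_addr.
Qed.

Lemma books_exist : exists P, disjoint_books G k P /\ #|P| = t.
Proof.
suff: forall s, s <= t -> exists P, disjoint_books G k P /\ #|P| = s by apply.
elim=> [|s IHs] lest.
  exists set0; rewrite cards0; split=> //; split=> [|Q]; last by rewrite inE.
  by apply/trivIsetP => Q; rewrite inE.
have [P [bP cP]] := IHs (ltnW lest).
by rewrite -cP; apply: extend_books => //; rewrite cP.
Qed.

End UpperBound.

(** * From vertex sets to embedded subgraphs, and the arrow relation *)

Lemma contains_copies_book (G : sgraph) k t (P : {set {set G}}) :
  disjoint_books G k P -> #|P| = t -> contains G (copies t (book k)).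
Proof.
move=> [/trivIsetP tP bP] <-.
have /fin_all_exists[x] : forall i : 'I_#|P|, exists x y (W : {set G}),
    [/\ sedge x y, #|W| = k, W \subset nbh x :&: nbh y
      & enum_val i = x |: (y |: W)] by move=> i; apply/bP/enum_valP.
case/fin_all_exists=> y /fin_all_exists[W xyW].
(* Copy [i] goes to the [i]-th member of [P]; the default of [nth] is never reached, as [W i] has
   [k] elements. *)
pose f (v : copies #|P| (book k)) : G :=
  match v.2 with
  | inl a => if a == ord0 then x v.1 else y v.1
  | inr j => nth (x v.1) (enum (W v.1)) j
  end.
have ltW i (j : 'I_k) : j < size (enum (W i)).
  by have [_ cW _ _] := xyW i; rewrite -cardE cW.
have fW i j : (nth (x i) (enum (W i)) j \in W i) = (j < k).
  have [_ cW _ _] := xyW i; case: ltnP => lej; last first.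
    rewrite nth_default -?cardE ?cW //; have [_ _ /subsetP sW _] := xyW i.
    by apply/negP => /sW; rewrite !inE sedge_irrefl.
  by rewrite -mem_enum mem_nth // -cardE cW.
have nbW i z : z \in W i -> sedge (x i) z /\ sedge (y i) z.
  have [_ _ /subsetP sW _] := xyW i.
  by move/sW; rewrite !inE => /andP.
exists f; split; last first.
  case=> i [a|j] [i' [b|j']] /andP[/= /eqP<-] //=; rewrite /f /=.
  - have [exy _ _ _] := xyW i; rewrite /complete_rel.
    have two (a' : 'I_2) : a' != ord0 -> a' = ord_max.
      by case: a' => -[|[|[]]] // i2 _; apply: val_inj.
    case: (eqVneq a ord0) => [Ea|/two Ea]; case: (eqVneq b ord0) => [Eb|/two Eb];
      by rewrite ?(sedge_sym (y i)) // Ea Eb eqxx.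
  - move=> _; have [ex ey] := nbW i (nth (x i) (enum (W i)) j') (etrans (fW i j') (ltn_ord j')).
    by case: ifP.
  - move=> _; have [ex ey] := nbW i (nth (x i) (enum (W i)) j) (etrans (fW i j) (ltn_ord j)).
    by rewrite sedge_sym; case: ifP.
have fQ v : f v \in enum_val v.1.
  case: v => i [a|j]; have [_ _ _ ->] := xyW i; rewrite /f !inE /=.
    by case: ifP; rewrite eqxx ?orbT.
  by rewrite fW ltn_ord !orbT.
have finj1 v w : f v = f w -> v.1 = w.1.
  move=> E; apply/enum_val_inj/eqP; apply/idPn => /tP.
  move=> /(_ (enum_valP _) (enum_valP _)) /disjointFr/(_ (fQ v)).
  by rewrite E fQ.
move=> [i a] [i' b] E; have /= Ei := finj1 _ _ E; rewrite -Ei in E *; congr (_, _).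
have irr z : z \in W i -> (z == x i) || (z == y i) = false.
  by case/nbW => ex ey; apply/negP => /orP[]/eqP E'; rewrite E' sedge_irrefl in ex ey.
have xy : x i == y i = false.
  by have [exy _ _ _] := xyW i; apply/negP => /eqP E'; rewrite E' sedge_irrefl in exy.
move: a b E => [a|j] [b|j']; rewrite /f /=.
- move=> E; congr inl; apply/val_inj; move: E xy; case: a b => [[|[|[]]] //= ?] [[|[|[]]] //= ?].
    by move=> ->; rewrite eqxx.
  by move=> ->; rewrite eqxx.
- move=> E; have := irr (nth (x i) (enum (W i)) j'); rewrite fW ltn_ord -E.
  by case: ifP; rewrite eqxx ?orbT => _ /(_ isT).
- move=> E; have := irr (nth (x i) (enum (W i)) j); rewrite fW ltn_ord E.
  by case: ifP; rewrite eqxx ?orbT => _ /(_ isT).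
by move/eqP; rewrite nth_uniq ?enum_uniq // => /eqP/val_inj->.
Qed.

Lemma contains_star (G : sgraph) m (v : G) : m <= #|nbh v| -> contains G (star m).
Proof.
move=> lem; pose f (w : star m) : G :=
  match w with inl _ => v | inr j => nth v (enum (nbh v)) j end.
have ltj (j : 'I_m) : j < size (enum (nbh v)).
  by rewrite -cardE (leq_trans _ lem).
have vf (j : 'I_m) : sedge v (nth v (enum (nbh v)) j).
  by rewrite -in_nbh -mem_enum mem_nth.
have nv (j : 'I_m) : v <> nth v (enum (nbh v)) j.
  by move=> E; have := vf j; rewrite -E sedge_irrefl.
exists f; split.
  move=> [a|j] [b|j'] //=; first by rewrite (ord1 a) (ord1 b).
  - by move/nv.
  - by move/esym/nv.
  by move/eqP; rewrite nth_uniq ?enum_uniq // => /eqP/val_inj->.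
by move=> [a|j] [b|j'] //= _; rewrite // sedge_sym.
Qed.

Lemma card_nbh_colors N (c : edge_coloring N) (v : 'I_N) :
  #|nbh (G := color_graph c red) v| + #|nbh (G := color_graph c blue) v| = N.-1.
Proof.
have [R B] : #|nbh (G := color_graph c red) v| =
      #|[set~ v] :&: [set w | c [set v; w]]| /\
    #|nbh (G := color_graph c blue) v| =
      #|[set~ v] :\: [set w | c [set v; w]]|.
  split; congr #|pred_of_set _|; apply/setP => w; rewrite !inE /=.
    by rewrite /color_rel /= /complete_rel eq_sym eqb_id.
  by rewrite /color_rel /= /complete_rel eq_sym eqbF_neg andbC.
by rewrite R B cardsID cardsC1 card_ord.
Qed.

Lemma arrows_star_books k t n : 0 < k -> 0 < t -> 3 * t * k + 3 * t - 5 <= n ->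
  arrows (2 * n + t - 2) (star (n - 1)) (copies t (book k)).
Proof.
move=> k_gt0 t_gt0 len c.
case: (boolP [exists v : 'I_(2 * n + t - 2), n - 1 <= #|nbh (G := color_graph c red) v|]).
  by case/existsP => v /contains_star; left.
rewrite negb_exists => /forallP small; right.
have [||P [bP cP]] := books_exist (G := color_graph c blue) k_gt0 len.
- by rewrite /= card_ord.
(* Of the [2n + t - 3] edges at [v] at most [n - 2] are red, which leaves at least [n + t - 1] blue
   ones. *)
- move=> v; have := small v; rewrite -ltnNge.
  have := card_nbh_colors c v; have := ltn_ord v.
  move=> /= lt_v; rewrite -subn1 => H1 H2.
  lia.
exact: contains_copies_book bP cP.
Qed.

(** * The lower bound: a coloring with neither subgraph *)

(* Everything at the first [t - 1] vertices is blue; the rest is split into two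
   red cliques of at most [n - 1] vertices each. *)
Definition extremal_coloring t n M : edge_coloring M := fun X =>
  [forall x in X, t <= x.+1] &&
  ([forall x in X, x.+2 < t + n] || [forall x in X, t + n <= x.+2]).

Lemma extremal_coloring2 t n M (x y : 'I_M) :
  extremal_coloring t n [set x; y] =
  [&& t <= x.+1, t <= y.+1 & (x.+2 < t + n) == (y.+2 < t + n)].
Proof.
have all2 (p : pred 'I_M) : [forall z in [set x; y], p z] = p x && p y.
  apply/forall_inP/andP => [pxy | [px py] z]; first by rewrite !pxy ?set21 ?set22.
  by case/set2P => ->.
rewrite /extremal_coloring !all2 -andbA !(leqNgt (t + n)).
by congr [&& _, _ & _]; case: (_.+2 < _); case: (_.+2 < _).
Qed.

(** A red star stays inside the clique of its centre, an interval of at most [n - 1] indices, but it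
    has [n] vertices. *)
Lemma extremal_coloring_no_red_star t n M : 1 < n -> M < 2 * n + t - 2 ->
  ~ contains (color_graph (extremal_coloring t n (M := M)) red) (star (n - 1)).
Proof.
move=> n_gt1 ltM [f [finj fE]].
pose v := f (inl ord0); pose low (x : 'I_M) := x.+2 < t + n.
have red_v (j : 'I_(n - 1)) :
    [&& t <= v.+1, t <= (f (inr j)).+1 & low v == low (f (inr j))].
  have /fE := isT : sedge (inl ord0 : star (n - 1)) (inr j).
  by case/andP=> _ /eqP; rewrite -/v extremal_coloring2.
(* The bound on the centre is read off a red edge, so a leaf is required. *)
have ltn1 : 0 < n - 1 by lia.
have tv : t <= v.+1 by case/and3P: (red_v (Ordinal ltn1)).
(* The first index of the red clique containing [v]. *)
pose start := if low v then t - 1 else t + n - 2.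
have inW w : start <= f w < start + (n - 1).
  have [tw lw] : t <= (f w).+1 /\ low v = low (f w).
    case: w => [a|j]; last by case/and3P: (red_v j) => ? ? /eqP.
    by rewrite (ord1 a).
  rewrite /start lw /low; have := ltn_ord (f w); case: ifP; lia.
have ltw w : f w - start < n - 1 by have := inW w; lia.
pose g w := Ordinal (ltw w).
have ginj : injective g.
  move=> w w' /(congr1 val) /= E; apply/finj/val_inj => /=.
  by have := inW w; have := inW w'; lia.
have := leq_card g ginj; rewrite card_sum !card_ord; lia.
Qed.

(** Disjoint books would use distinct vertices among the first [t - 1], one for each of the [t]
    books. *)
Lemma extremal_coloring_no_blue_books k t n M : 0 < k -> 0 < t ->
  ~ contains (color_graph (extremal_coloring t n (M := M)) blue) (copies t (book k)).
Proof.
move=> k_gt0 t_gt0 [f [finj fE]].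
have hub (i : 'I_t) : exists a, (f (i, a)).+1 < t.
  pose a0 : book k := inl ord0; pose a1 : book k := inl ord_max.
  pose a2 : book k := inr (Ordinal k_gt0).
  have blue_e a b : sedge (a : book k) b ->
      ~~ [&& t <= (f (i, a)).+1, t <= (f (i, b)).+1
           & ((f (i, a)).+2 < t + n) == ((f (i, b)).+2 < t + n)].
    move=> eab; have /fE : sedge ((i, a) : copies t (book k)) (i, b).
      by rewrite /= /copies_rel /= eqxx.
    by case/andP => _; rewrite extremal_coloring2 eqbF_neg.
  move: (blue_e a0 a1 isT) (blue_e a0 a2 isT) (blue_e a1 a2 isT).
  case: (ltnP (f (i, a0)).+1 t) => [|_]; first by exists a0.
  case: (ltnP (f (i, a1)).+1 t) => [|_]; first by exists a1.
  case: (ltnP (f (i, a2)).+1 t) => [|_]; first by exists a2.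
  (* Of three vertices outside the first [t - 1], two lie in the same red clique. *)
  by do 3![case: (_.+2 < _)].
have /fin_all_exists[a lta] := hub.
have lta' i : f (i, a i) < t.-1 by rewrite -ltnS prednK ?lta.
pose g i := Ordinal (lta' i).
have ginj : injective g.
  by move=> i j /(congr1 val) /= /val_inj /finj [].
by have := leq_card g ginj; rewrite !card_ord; lia.
Qed.

Theorem theorem1p9 (k t n : nat) (hk : 0 < k) (ht : 0 < t)
    (hn : 3 * t * k + 3 * t - 5 <= n) :
  ramsey_number (star (n - 1)) (copies t (book k)) (2 * n + t - 2).
Proof.
have tk : t + k <= t * k + 1 by nia.
split; [lia | exact: arrows_star_books | move=> M M_gt0 arrM].
rewrite leqNgt; apply/negP => ltM.
have [|] := arrM (extremal_coloring t n (M := M)).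
  (* If [n = 1], then [t = k = 1] and no positive [M] is below [2n + t - 2 = 1]. *)
  by apply: extremal_coloring_no_red_star => //; lia.
exact: extremal_coloring_no_blue_books.
Qed.
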